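(* Let $\Sigma$ (primitive actions) and $\Omega$ (primitive tests) be finite sets, and let $\mathcal{H}_{\mathrm{kat}}$ be the set of hypotheses described in the context, over the alphabet $\Sigma+T_{\mathrm{BA}}$. For all regular expressions $e,f$ over the alphabet $\Sigma+T_{\mathrm{BA}}$, if $\mathcal{H}_{\mathrm{kat}}^\star(\llbracket e\rrbracket)=\mathcal{H}_{\mathrm{kat}}^\star(\llbracket f\rrbracket)$, then $\mathsf{KA}_{\mathcal{H}_{\mathrm{kat}}}\vdash e=f$.
   Context: Regular expressions over an alphabet $X$ are given by $e,f::=e+f\mid e\cdot f\mid e^*\mid 0\mid 1\mid a$ ($a\in X$); $\llbracket e\rrbracket\subseteq X^*$ is the usual language. A Kleene algebra is an idempotent semiring $(K,+,\cdot,0,1)$ with a unary $^*$ such that $1+xx^*\le x^*$, $x+yz\le z\Rightarrow y^*x\le z$, and $x+yz\le y\Rightarrow xz^*\le y$, where $x\le y$ means $x+y=y$. A hypothesis is a pair of regular expressions written $e\le f$; an equation $e=f$ used as a hypothesis stands for the two hypotheses $e\le f$ and $f\le e$. For a set $H$ of hypotheses, $\mathsf{KA}_H\vdash e=f$ means $e=f$ is derivable in equational logic from all instances of the Kleene algebra axioms together with the hypotheses of $H$, where letters are constants (there is no substitution rule). The $H$-closure $H^\star(L)$ of a language $L\subseteq X^*$ is the smallest language containing $L$ such that for all $e\le f\in H$ and all words $u,v$, if $u\llbracket f\rrbracket v\subseteq H^\star(L)$ then $u\llbracket e\rrbracket v\subseteq H^\star(L)$. $T_{\mathrm{BA}}$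 is the set of Boolean expressions $\phi,\psi::=\phi\vee\psi\mid\phi\wedge\psi\mid\neg\phi\mid\bot\mid\top\mid o$ ($o\in\Omega$); each element of $T_{\mathrm{BA}}$ is a single letter of the alphabet $\Sigma+T_{\mathrm{BA}}$. $\mathcal{H}_{\mathrm{bool}}$ is the set of all equations $\phi=\psi$ between Boolean expressions that are instances of the Boolean algebra axioms; $\mathcal{H}_{\mathrm{glue}}=\{\phi\wedge\psi=\phi\cdot\psi,\ \phi\vee\psi=\phi+\psi\mid\phi,\psi\in T_{\mathrm{BA}}\}\cup\{\bot=0,\ \top=1\}$ (on the left the connective is inside a single letter, on the right it is the regular-expression operation/constant); $\mathcal{H}_{\mathrm{kat}}=\mathcal{H}_{\mathrm{bool}}\cup\mathcal{H}_{\mathrm{glue}}$. *)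

(* Defs.v *)
From mathcomp Require Import all_boot.
From mathcomp Require Import boolp classical_sets.

Set Implicit Arguments.
Unset Strict Implicit.
Unset Printing Implicit Defensive.

Local Open Scope classical_set_scope.

Inductive regexp (X : Type) : Type :=
| re0
| re1
| reL of X
| reD of regexp X & regexp X
| reM of regexp X & regexp X
| reS of regexp X.

Arguments re0 {X}.
Arguments re1 {X}.

Declare Scope regexp_scope.
Delimit Scope regexp_scope with RE.
Bind Scope regexp_scope with regexp.
Notation "0" := re0 : regexp_scope.
Notation "1" := re1 : regexp_scope.
Notation "e + f" := (reD e f) : regexp_scope.
Notation "e * f" := (reM e f) : regexp_scope.
Notation "e ^*" := (reS e) : regexp_scope.

Definition language (X : Type) := set (seq X).

Definition lang_cat (X : Type) (A B : language X) : language X :=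
  [set u ++ v | u in A & v in B].

Definition lang_star (X : Type) (A : language X) : language X :=
  \bigcup_(n in [set: nat]) iter n (lang_cat A) [set [::]].

Fixpoint lang (X : Type) (e : regexp X) : language X :=
  match e with
  | re0 => set0
  | re1 => [set [::]]
  | reL a => [set [:: a]]
  | reD e f => lang e `|` lang f
  | reM e f => lang_cat (lang e) (lang f)
  | reS e => lang_star (lang e)
  end.

(* The pair (e, f) stands for the hypothesis e <= f. *)
Definition hypotheses (X : Type) := set (regexp X * regexp X).

Definition hyps_of_eqs (X : Type) (E : regexp X -> regexp X -> Prop) :
  hypotheses X := [set p | E p.1 p.2 \/ E p.2 p.1].

Definition lang_context (X : Type) (u : seq X) (A : language X) (v : seq X) :
  language X := [set u ++ w ++ v | w in A].

Definition hyps_closed (X : Type) (H : hypotheses X) (L : language X) : Prop :=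
  forall (e f : regexp X) (u v : seq X), H (e, f) ->
    lang_context u (lang f) v `<=` L -> lang_context u (lang e) v `<=` L.

Definition hyps_closure (X : Type) (H : hypotheses X) (L : language X) :
  language X := smallest (hyps_closed H) L.

(* In the rules below, x <= y is spelled out as x + y = y. *)
Inductive KA_eq (X : Type) (H : hypotheses X) :
  regexp X -> regexp X -> Prop :=
| KA_refl x : KA_eq H x x
| KA_sym x y : KA_eq H x y -> KA_eq H y x
| KA_trans x y z : KA_eq H x y -> KA_eq H y z -> KA_eq H x z
| KA_congD x x' y y' :
    KA_eq H x x' -> KA_eq H y y' -> KA_eq H (x + y) (x' + y')
| KA_congM x x' y y' :
    KA_eq H x x' -> KA_eq H y y' -> KA_eq H (x * y) (x' * y')
| KA_congS x x' : KA_eq H x x' -> KA_eq H (x^*) (x'^*)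
| KA_addA x y z : KA_eq H (x + (y + z)) (x + y + z)
| KA_addC x y : KA_eq H (x + y) (y + x)
| KA_addxx x : KA_eq H (x + x) x
| KA_add0 x : KA_eq H (0 + x) x
| KA_mulA x y z : KA_eq H (x * (y * z)) (x * y * z)
| KA_mul1l x : KA_eq H (1 * x) x
| KA_mul1r x : KA_eq H (x * 1) x
| KA_mul0l x : KA_eq H (0 * x) 0
| KA_mul0r x : KA_eq H (x * 0) 0
| KA_mulDl x y z : KA_eq H ((x + y) * z) (x * z + y * z)
| KA_mulDr x y z : KA_eq H (x * (y + z)) (x * y + x * z)
| KA_star_unfold x : KA_eq H ((1 + x * x^*) + x^*) (x^*)
| KA_star_indl x y z :
    KA_eq H ((x + y * z) + z) z -> KA_eq H (y^* * x + z) z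
| KA_star_indr x y z :
    KA_eq H ((x + y * z) + y) y -> KA_eq H (x * z^* + y) y
| KA_hyp e f : H (e, f) -> KA_eq H (e + f) f.

Inductive bexp (Omega : Type) : Type :=
| b_or of bexp Omega & bexp Omega
| b_and of bexp Omega & bexp Omega
| b_not of bexp Omega
| b_bot
| b_top
| b_test of Omega.

Arguments b_bot {Omega}.
Arguments b_top {Omega}.

(* Instances of the axioms of Boolean algebras, taken as complemented
   distributive lattices. The axioms are not closed under congruence: only the
   two sides of an instance, as whole expressions, are related. *)
Inductive BA_axiom (Omega : Type) : bexp Omega -> bexp Omega -> Prop :=
| BA_orA p q r : BA_axiom (b_or p (b_or q r)) (b_or (b_or p q) r)
| BA_andA p q r : BA_axiom (b_and p (b_and q r)) (b_and (b_and p q) r)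
| BA_orC p q : BA_axiom (b_or p q) (b_or q p)
| BA_andC p q : BA_axiom (b_and p q) (b_and q p)
| BA_orK p q : BA_axiom (b_or p (b_and p q)) p
| BA_andK p q : BA_axiom (b_and p (b_or p q)) p
| BA_or_and p q r :
    BA_axiom (b_or p (b_and q r)) (b_and (b_or p q) (b_or p r))
| BA_and_or p q r :
    BA_axiom (b_and p (b_or q r)) (b_or (b_and p q) (b_and p r))
| BA_or_bot p : BA_axiom (b_or p b_bot) p
| BA_and_top p : BA_axiom (b_and p b_top) p
| BA_or_not p : BA_axiom (b_or p (b_not p)) b_top
| BA_and_not p : BA_axiom (b_and p (b_not p)) b_bot.

Definition kat_letter (Sigma Omega : Type) := (Sigma + bexp Omega)%type.

Definition test (Sigma Omega : Type) (p : bexp Omega) :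
  regexp (kat_letter Sigma Omega) := reL (inr p).

Arguments test Sigma {Omega} p.

Inductive bool_eq (Sigma Omega : Type) :
  regexp (kat_letter Sigma Omega) -> regexp (kat_letter Sigma Omega) -> Prop :=
| bool_eq_axiom p q :
    BA_axiom p q -> bool_eq (test Sigma p) (test Sigma q).

Inductive glue_eq (Sigma Omega : Type) :
  regexp (kat_letter Sigma Omega) -> regexp (kat_letter Sigma Omega) -> Prop :=
| glue_and p q :
    glue_eq (test Sigma (b_and p q)) (test Sigma p * test Sigma q)
| glue_or p q :
    glue_eq (test Sigma (b_or p q)) (test Sigma p + test Sigma q)
| glue_bot : glue_eq (test Sigma b_bot) 0
| glue_top : glue_eq (test Sigma b_top) 1.

Definition hyps_bool (Sigma Omega : Type) :
  hypotheses (kat_letter Sigma Omega) := hyps_of_eqs (@bool_eq Sigma Omega).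

Arguments hyps_bool : clear implicits.

Definition hyps_glue (Sigma Omega : Type) :
  hypotheses (kat_letter Sigma Omega) := hyps_of_eqs (@glue_eq Sigma Omega).

Arguments hyps_glue : clear implicits.

Definition hyps_kat (Sigma Omega : Type) :
  hypotheses (kat_letter Sigma Omega) :=
  hyps_bool Sigma Omega `|` hyps_glue Sigma Omega.

Arguments hyps_kat : clear implicits.

(* Main.v *)
(* A word l over Sigma + T_BA denotes a set of guarded strings (gword l), and a
   hypothesis e <= f of hyps_kat only relates expressions with glang e included
   in glang f. So the words all of whose guarded strings lie in glang f form a
   closed language containing lang f, and equality of closures yields
   glang e = glang f.

   To derive e <= f from glang e included in glang f, take a nondeterministic
   automaton that accepts glang f and whose states s carry expressions g(s) with
   al a g(t) <= g(s) along transitions, al <= g(s) at accepting states and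
   g(i) <= f at initial states. Each guarded string acts as a relation on the
   states, and these relations form a finite monoid. The star of the matrix of
   its Cayley graph gives an expression K(al, m, be) for the guarded strings
   from al to be that act as m, with K(al, m, be) K(be, n, ga) <= K(al, mn, ga).
   Hence e <= sum of the K(al, m, be) over the classes met by glang e, by
   induction on e, and each of these is below f, because m relates an initial
   state to a state accepting be. *)

Require Import Defs.
From mathcomp Require Import all_boot.
From mathcomp Require Import boolp classical_sets.
From Stdlib Require Import Setoid Morphisms.

Set Implicit Arguments.
Unset Strict Implicit.
Unset Printing Implicit Defensive.

Local Open Scope regexp_scope.

Definition KA_le (X : Type) (H : hypotheses X) (x y : regexp X) : Prop :=
  KA_eq H (x + y) y.

Notation "\re_sum_ ( i | P ) F" := (\big[@reD _/re0]_(i | P%B) F%RE)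
  (at level 41, i at level 50, F at level 41) : regexp_scope.
Notation "\re_sum_ i F" := (\big[@reD _/re0]_i F%RE)
  (at level 41, i at level 0, F at level 41) : regexp_scope.

(** * Kleene algebra modulo hypotheses *)

Section KleeneAlgebra.
Context (X : Type) (H : hypotheses X).
Local Notation "x =ka y" := (KA_eq H x y) (at level 70).
Local Notation "x <=ka y" := (KA_le H x y) (at level 70).

#[global] Instance KA_eq_equiv : Equivalence (KA_eq H).
Proof. split; [exact: KA_refl | exact: KA_sym | exact: KA_trans]. Qed.

Local Hint Resolve KA_refl : core.

#[global] Instance reD_proper :
  Proper (KA_eq H ==> KA_eq H ==> KA_eq H) (@reD X).
Proof. by move=> x x' xx' y y' yy'; apply: KA_congD. Qed.

#[global] Instance reM_proper :
  Proper (KA_eq H ==> KA_eq H ==> KA_eq H) (@reM X).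
Proof. by move=> x x' xx' y y' yy'; apply: KA_congM. Qed.

#[global] Instance KA_le_proper :
  Proper (KA_eq H ==> KA_eq H ==> iff) (KA_le H).
Proof. by move=> x x' xx' y y' yy'; rewrite /KA_le xx' yy'. Qed.

Lemma KA_le_refl x : x <=ka x.
Proof. exact: KA_addxx. Qed.

Local Hint Resolve KA_le_refl : core.

Lemma KA_le_trans y x z : x <=ka y -> y <=ka z -> x <=ka z.
Proof. by rewrite /KA_le => xy <-; rewrite KA_addA xy. Qed.

Lemma KA_le_anti x y : x <=ka y -> y <=ka x -> x =ka y.
Proof. move=> xy yx; apply: KA_trans xy; apply: KA_trans (KA_addC _ _ _).
exact: KA_sym. Qed.

Lemma KA_le0x x : 0 <=ka x.
Proof. exact: KA_add0. Qed.

Lemma KA_leDl x y : x <=ka x + y.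
Proof. by rewrite /KA_le KA_addA KA_addxx. Qed.

Lemma KA_leDr x y : y <=ka x + y.
Proof. by rewrite KA_addC; apply: KA_leDl. Qed.

Lemma KA_leUD x y z : x <=ka z -> y <=ka z -> x + y <=ka z.
Proof. by rewrite /KA_le -KA_addA => xz ->. Qed.

Lemma KA_le_mul2 x x' y y' : x <=ka x' -> y <=ka y' -> x * y <=ka x' * y'.
Proof.
rewrite /KA_le => <- <-; rewrite KA_mulDl !KA_mulDr !KA_addA.
by rewrite KA_addxx.
Qed.

Lemma KA_le_mull x y z : y <=ka z -> x * y <=ka x * z.
Proof. exact/KA_le_mul2/KA_le_refl. Qed.

Lemma KA_le_mulr x y z : x <=ka y -> x * z <=ka y * z.
Proof. by move=> xy; apply/KA_le_mul2/KA_le_refl. Qed.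

Lemma KA_le1_star x : 1 <=ka x^*.
Proof. by apply: KA_le_trans (KA_star_unfold H x); apply: KA_leDl. Qed.

Lemma KA_le_mul_star x : x * x^* <=ka x^*.
Proof. by apply: KA_le_trans (KA_star_unfold H x); apply: KA_leDr. Qed.

Lemma KA_star_le x z : 1 <=ka z -> x * z <=ka z -> x^* <=ka z.
Proof.
move=> z1 xz; rewrite -[x^*](KA_mul1r H).
by apply: KA_star_indl; apply: KA_leUD.
Qed.

Lemma KA_star_mull x z : x * z <=ka z -> x^* * z <=ka z.
Proof.
by move=> xz; apply: KA_star_indl; apply: KA_leUD => //; apply: KA_le_refl.
Qed.

Lemma KA_star_mul_star x : x^* * x^* <=ka x^*.
Proof. exact/KA_star_mull/KA_le_mul_star. Qed.

Lemma KA_le_star x : x <=ka x^*.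
Proof.
apply: KA_le_trans (KA_le_mul_star x).
by rewrite -[X in X <=ka _](KA_mul1r H); apply/KA_le_mull/KA_le1_star.
Qed.

Lemma KA_star_mul_le x : x^* * x <=ka x^*.
Proof.
exact: KA_le_trans (KA_le_mull _ (KA_le_star x)) (KA_star_mul_star x).
Qed.

Lemma KA_le_sum (I : finType) (P : pred I) (F : I -> regexp X) j :
  P j -> F j <=ka \re_sum_(i | P i) F i.
Proof.
move=> Pj; have: j \in index_enum I by rewrite mem_index_enum.
elim: (index_enum I) => // i s IHs; rewrite big_cons inE.
have [<-|_ /= /IHs js] := eqVneq j i; first by rewrite Pj => _; apply: KA_leDl.
by case: (P i) => //; apply: KA_le_trans js (KA_leDr _ _).
Qed.

Lemma KA_sum_le (I : finType) (P : pred I) (F : I -> regexp X) z :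
  (forall i, P i -> F i <=ka z) -> \re_sum_(i | P i) F i <=ka z.
Proof.
by move=> Fz; elim/big_ind: _ => // *; [apply: KA_le0x | apply: KA_leUD].
Qed.

Lemma KA_sum_mulr_le (I : finType) (P : pred I) (F : I -> regexp X) x z :
  (forall i, P i -> F i * x <=ka z) -> (\re_sum_(i | P i) F i) * x <=ka z.
Proof.
move=> Fz; elim/big_ind: _ => // [|a b az bz].
  by rewrite KA_mul0l; apply: KA_le0x.
by rewrite KA_mulDl; apply: KA_leUD.
Qed.

Lemma KA_sum_mull_le (I : finType) (P : pred I) (F : I -> regexp X) x z :
  (forall i, P i -> x * F i <=ka z) -> x * (\re_sum_(i | P i) F i) <=ka z.
Proof.
move=> Fz; elim/big_ind: _ => // [|a b az bz].
  by rewrite KA_mul0r; apply: KA_le0x.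
by rewrite KA_mulDr; apply: KA_leUD.
Qed.

Lemma KA_le_muls x y z t : y * z <=ka t -> x * y * z <=ka x * t.
Proof. by move=> yzt; rewrite -KA_mulA; apply: KA_le_mull. Qed.

(* The star of a matrix by Warshall's algorithm: [paths_via ks x y] is the sum
   over nonempty paths from x to y with inner vertices in ks. *)
Section MatrixStar.
Variables (Q : finType) (A : Q -> Q -> regexp X).

Fixpoint paths_via (ks : seq Q) (x y : Q) : regexp X :=
  if ks is k :: ks' then
    let P := paths_via ks' in P x y + P x k * (P k k)^* * P k y
  else A x y.

Lemma le_paths_via ks x y : A x y <=ka paths_via ks x y.
Proof.
elim: ks => [|k ks IHks] /=; first exact: KA_le_refl.
exact: KA_le_trans IHks (KA_leDl _ _).
Qed.

(** The vertex [k] where the two paths meet becomes an inner vertex of the concatenation, hence the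
    condition that it lies in [ks]. *)
Lemma paths_via_trans ks k x y :
  k \in ks -> paths_via ks x k * paths_via ks k y <=ka paths_via ks x y.
Proof.
elim: ks k x y => //= j ks IHks k x y; rewrite inE.
set P := paths_via ks; set s := (P j j)^*.
move=> /orP[/eqP ->|kks].
  apply: KA_le_trans (KA_leDr _ _).
  have Pl u : P u j + P u j * s * P j j <=ka P u j * s.
    apply: KA_leUD.
      rewrite -[X in X <=ka _](KA_mul1r H).
      exact/KA_le_mull/KA_le1_star.
    exact/KA_le_muls/KA_star_mul_le.
  have Pr u : P j u + P j j * s * P j u <=ka s * P j u.
    apply: KA_leUD.
      rewrite -[X in X <=ka _](KA_mul1l H).
      exact/KA_le_mulr/KA_le1_star.
    exact/KA_le_mulr/KA_le_mul_star.
  apply: KA_le_trans (KA_le_mul2 (Pl _) (Pr _)) _.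
  rewrite KA_mulA; apply: KA_le_mulr.
  exact/KA_le_muls/KA_star_mul_star.
have Pk u v : P u k * P k v <=ka P u v by apply: IHks.
rewrite KA_mulDl !KA_mulDr.
(* Four products, according to which factors visit [j]. If both do, the detour from [j] through [k]
   back to [j] is at most [P j j] and is absorbed by the star [s]. *)
apply: KA_leUD; apply: KA_leUD; last 3 first.
- apply: KA_le_trans (KA_leDr _ _); rewrite !KA_mulA.
  exact/KA_le_mulr/KA_le_mulr/Pk.
- apply: KA_le_trans (KA_leDr _ _); exact/KA_le_muls/Pk.
- apply: KA_le_trans (KA_leDr _ _); rewrite !KA_mulA; apply: KA_le_mulr.
  apply: (KA_le_trans (y := P x j * s * P j j * s)).
    by apply: KA_le_mulr; apply: KA_le_muls.
  apply: KA_le_trans (KA_le_muls _ (KA_star_mul_star _)).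
  by apply: KA_le_mulr; apply: KA_le_muls; apply: KA_star_mul_le.
exact: KA_le_trans (Pk _ _) (KA_leDl _ _).
Qed.

(** Matrix form of star induction, applied at the pivot [k] in each round: a column [z] that absorbs
    [A] absorbs all paths. *)
Lemma paths_via_least ks (z : Q -> regexp X) :
  (forall x y, A x y * z y <=ka z x) ->
  forall x y, paths_via ks x y * z y <=ka z x.
Proof.
move=> Az; elim: ks => //= k ks IHks x y; rewrite KA_mulDl.
apply: KA_leUD => //; apply: KA_le_trans (IHks x k).
rewrite -!KA_mulA; apply: KA_le_mull.
apply: KA_le_trans (KA_le_mull _ (IHks _ _)) _.
exact/KA_star_mull.
Qed.

Definition mat_star (x y : Q) : regexp X :=
  (if x == y then 1 else 0)%B + paths_via (enum Q) x y.

Lemma mat_star1 x : 1 <=ka mat_star x x.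
Proof. by rewrite /mat_star eqxx; apply: KA_leDl. Qed.

Lemma le_mat_star x y : A x y <=ka mat_star x y.
Proof. exact: KA_le_trans (le_paths_via _ _ _) (KA_leDr _ _). Qed.

Lemma mat_star_trans k x y : mat_star x k * mat_star k y <=ka mat_star x y.
Proof.
rewrite {1 2}/mat_star KA_mulDl; apply: KA_leUD.
  case: eqP => [->|_]; first by rewrite KA_mul1l.
  by rewrite KA_mul0l; apply: KA_le0x.
rewrite KA_mulDr; apply: KA_leUD; apply: KA_le_trans (KA_leDr _ _).
  case: eqP => [->|_]; first by rewrite KA_mul1r.
  by rewrite KA_mul0r; apply: KA_le0x.
by apply: paths_via_trans; rewrite mem_enum.
Qed.

Lemma mat_star_least (z : Q -> regexp X) :
  (forall x y, A x y * z y <=ka z x) ->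
  forall x y, mat_star x y * z y <=ka z x.
Proof.
move=> Az x y; rewrite KA_mulDl; apply: KA_leUD; last exact: paths_via_least.
case: eqP => [->|_]; first by rewrite KA_mul1l.
by rewrite KA_mul0l; apply: KA_le0x.
Qed.

End MatrixStar.
End KleeneAlgebra.

(** * Tests and atoms *)

Section KAT.
Context (Sigma Omega : finType).

Local Notation letter := (kat_letter Sigma Omega).
Local Notation H := (hyps_kat Sigma Omega).
Local Notation "x =ka y" := (KA_eq H x y) (at level 70).
Local Notation "x <=ka y" := (KA_le H x y) (at level 70).
Local Notation atom := {ffun Omega -> bool}.
Local Notation test := (test Sigma).
Local Hint Resolve KA_refl KA_le_refl : core.

Fixpoint beval (al : atom) (p : bexp Omega) : bool :=
  match p with
  | b_or p q => beval al p || beval al q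
  | b_and p q => beval al p && beval al q
  | b_not p => ~~ beval al p
  | b_bot => false
  | b_top => true
  | b_test o => al o
  end.

Lemma BA_axiom_beval p q al : BA_axiom p q -> beval al p = beval al q.
Proof.
by case=> * /=;
  repeat match goal with |- context [beval al ?r] => case: (beval al r) end.
Qed.

Lemma test_BA p q : BA_axiom p q -> test p =ka test q.
Proof.
by move=> pq; apply: KA_le_anti; apply: KA_hyp; left; [left | right];
  apply: bool_eq_axiom.
Qed.

Lemma glue_KA_eq x y : glue_eq x y -> x =ka y.
Proof.
by move=> xy; apply: KA_le_anti; apply: KA_hyp; right; [left | right].
Qed.

Lemma test_and p q : test (b_and p q) =ka test p * test q.
Proof. exact/glue_KA_eq/glue_and. Qed.

Lemma test_or p q : test (b_or p q) =ka test p + test q.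
Proof. exact/glue_KA_eq/glue_or. Qed.

Lemma test_bot : test b_bot =ka 0.
Proof. exact/glue_KA_eq/glue_bot. Qed.

Lemma test_top : test b_top =ka 1.
Proof. exact/glue_KA_eq/glue_top. Qed.

Lemma test_not p : test p + test (b_not p) =ka 1.
Proof. by rewrite -test_or (test_BA (BA_or_not _)) test_top. Qed.

Lemma test_mul_not p : test p * test (b_not p) =ka 0.
Proof. by rewrite -test_and (test_BA (BA_and_not _)) test_bot. Qed.

Lemma test_mulC p q : test p * test q =ka test q * test p.
Proof. by rewrite -!test_and; apply/test_BA/BA_andC. Qed.

Lemma test_mulxx p : test p * test p =ka test p.
Proof.
(* Idempotence is not among the axioms, and nothing can be rewritten inside a letter. Absorption
   with [b_bot] becomes [p * (p + 0) = p] once gluing has split the letter. *)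
have: test (b_and p (b_or p b_bot)) =ka test p by apply/test_BA/BA_andK.
by rewrite test_and test_or test_bot (KA_addC _ (test p)) KA_add0.
Qed.

Lemma test_le1 p : test p <=ka 1.
Proof. by rewrite -(test_not p); apply: KA_leDl. Qed.

Lemma test_mull_le p x : test p * x <=ka x.
Proof.
by apply: KA_le_trans (KA_le_mulr _ (test_le1 p)) _; rewrite KA_mul1l.
Qed.

Lemma test_mulr_le p x : x * test p <=ka x.
Proof.
by apply: KA_le_trans (KA_le_mull _ (test_le1 p)) _; rewrite KA_mul1r.
Qed.

Lemma mul_le0 x x' y y' : x <=ka x' -> y <=ka y' -> x' * y' <=ka 0 ->
  x * y <=ka 0.
Proof. by move=> xx' yy'; apply: KA_le_trans; apply: KA_le_mul2. Qed.

Definition literal (al : atom) (o : Omega) : bexp Omega :=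
  if al o then b_test o else b_not (b_test o).

Definition conj_literals (al : atom) (s : seq Omega) : bexp Omega :=
  foldr (fun o p => b_and (literal al o) p) b_top s.

(** The literals are conjoined inside a single letter, so that the laws for tests apply to atoms
    directly. *)
Definition atest (al : atom) : regexp letter :=
  test (conj_literals al (enum Omega)).

Lemma atest_le_literal al o : atest al <=ka test (literal al o).
Proof.
have: o \in enum Omega by rewrite mem_enum.
rewrite /atest; elim: (enum Omega) => //= o' s IHs.
rewrite inE test_and => /predU1P[->|/IHs os]; first exact: test_mulr_le.
exact: KA_le_trans (test_mull_le _ _) os.
Qed.

(** Both halves go through one induction because negation exchanges them. *)
Lemma atest_beval al p :
  (beval al p -> atest al <=ka test p) /\
  (~~ beval al p -> atest al * test p <=ka 0).
Proof.
elim: p => [p [p1 p0] q [q1 q0]|p [p1 p0] q [q1 q0]|p [p1 p0]|||o] /=.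
- split=> [|].
    rewrite test_or => /orP[/p1|/q1] alp; apply: KA_le_trans alp _.
      exact: KA_leDl.
    exact: KA_leDr.
  rewrite negb_or test_or KA_mulDr => /andP[np nq].
  by apply: KA_leUD; [apply: p0 | apply: q0].
- split=> [/andP[/p1 alp /q1 alq]|].
    rewrite -[X in X <=ka _]test_mulxx test_and; exact: KA_le_mul2.
  rewrite negb_and => /orP[/p0|/q0] alp0.
    rewrite test_and KA_mulA -(KA_mul0l H (test q)); exact: KA_le_mulr.
  rewrite test_and test_mulC KA_mulA -(KA_mul0l H (test p)).
  exact: KA_le_mulr.
- split=> [np|/negPn/p1 alp].
    rewrite -[X in X <=ka _](KA_mul1r H) -(test_not p) KA_mulDr.
    apply: KA_leUD; last exact: test_mull_le.
    exact: KA_le_trans (p0 np) (KA_le0x _ _).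
  by apply: mul_le0 alp (KA_le_refl _ _) _; rewrite test_mul_not.
- by split=> // _; rewrite test_bot KA_mul0r.
- by split=> // _; rewrite test_top; apply: test_le1.
- have := atest_le_literal al o; rewrite /literal.
  case: (al o) => alo; split=> // _.
  by apply: mul_le0 alo (KA_le_refl _ _) _; rewrite test_mulC test_mul_not.
Qed.

Lemma atest_le al p : beval al p -> atest al <=ka test p.
Proof. exact: (atest_beval al p).1. Qed.

Lemma atest_mul_le0 al p : ~~ beval al p -> atest al * test p <=ka 0.
Proof. exact: (atest_beval al p).2. Qed.

Lemma atest_mulxx al : atest al * atest al =ka atest al.
Proof. exact: test_mulxx. Qed.

(** An atom that satisfies all literals of [be] agrees with [be] everywhere, so [al] falsifies the
    test [atest be]. *)
Lemma atest_mul_neq al be : al != be -> atest al * atest be <=ka 0.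
Proof.
move=> albe; apply: atest_mul_le0; apply: contra albe => alP.
apply/eqP/ffunP => o; have: o \in enum Omega by rewrite mem_enum.
elim: (enum Omega) alP => //= o' s IHs /andP[alo' als].
rewrite inE => /predU1P[->|]; last exact: IHs.
by move: alo'; rewrite /literal; case: (be o') => //= /negPf.
Qed.

Lemma eq_conj_literals (al be : atom) s :
  {in s, al =1 be} -> conj_literals al s = conj_literals be s.
Proof.
elim: s => //= o s IHs albe; rewrite /literal albe ?mem_head // IHs //.
by move=> o' o's; rewrite albe // inE o's orbT.
Qed.

Lemma sum_conj_literals s :
  uniq s -> 1 <=ka \re_sum_al test (conj_literals al s).
Proof.
elim: s => /= [_|o s IHs /andP[os /IHs {}IHs]].
  (* Any atom would do here, since the empty conjunction is [b_top]. *)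
  rewrite -test_top; exact: (KA_le_sum _ _ (j := [ffun=> true])).
rewrite -[X in X <=ka _](KA_mul1l H).
apply: KA_le_trans (KA_le_mull _ IHs) _.
apply: KA_sum_mull_le => al _; rewrite -(test_not (b_test o)) KA_mulDl.
(* Splitting 1 into [o] and its negation fixes the value at [o]. As [o] is not in [s], overriding
   [al] there leaves the literals over [s] unchanged. *)
pose upd b : atom := [ffun o' => if o' == o then b else al o'].
have updP b : conj_literals al s = conj_literals (upd b) s.
  apply: eq_conj_literals => o' o's; rewrite ffunE; case: eqP => // o'o.
  by rewrite -o'o o's in os.
apply: KA_leUD; rewrite -test_and.
  apply: KA_le_trans (KA_le_sum _ _ (j := upd true) _) => //=.
  by rewrite -updP /literal ffunE eqxx.
apply: KA_le_trans (KA_le_sum _ _ (j := upd false) _) => //=.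
by rewrite -updP /literal ffunE eqxx.
Qed.

Lemma sum_atest : 1 <=ka \re_sum_al atest al.
Proof. exact/sum_conj_literals/enum_uniq. Qed.

(** * Guarded strings *)

Local Notation gtail := (seq (Sigma * atom)).

Definition gend (al : atom) (w : gtail) : atom := last al (unzip2 w).

(* A guarded string al a1 al1 ... an aln is encoded as al together with the
   list of the pairs (ai, ali). *)
Fixpoint gword (l : seq letter) (al : atom) (w : gtail) : Prop :=
  match l with
  | [::] => w = [::]
  | inl a :: l' => exists ga w', w = (a, ga) :: w' /\ gword l' ga w'
  | inr p :: l' => beval al p /\ gword l' al w
  end.

Lemma gend_cat al w1 w2 : gend al (w1 ++ w2) = gend (gend al w1) w2.
Proof. by rewrite /gend /unzip2 map_cat last_cat. Qed.

Lemma gword_cat l1 l2 al w :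
  gword (l1 ++ l2) al w <->
  exists w1 w2, [/\ w = w1 ++ w2, gword l1 al w1 & gword l2 (gend al w1) w2].
Proof.
elim: l1 al w => [|[a|p] l1 IHl] al w /=.
- split=> [wl|[w1 [w2 [-> -> //]]]]; by exists [::], w.
- split.
    move=> [ga [w' [-> /IHl[w1 [w2 [-> l1w l2w]]]]]].
    by exists ((a, ga) :: w1), w2; split=> //; exists ga, w1.
  move=> [w1 [w2 [-> [ga [w' [-> l1w]]] l2w]]].
  by exists ga, (w' ++ w2); split=> //; apply/IHl; exists w', w2.
- split.
    by move=> [alp /IHl[w1 [w2 [-> l1w l2w]]]]; exists w1, w2.
  move=> [w1 [w2 [-> [alp l1w] l2w]]]; split=> //.
  by apply/IHl; exists w1, w2.
Qed.

(** The guarded-string semantics of Kleene algebra with tests, taken through words and not by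
    recursion on [e], so that it depends on [lang e] alone. *)
Definition glang (e : regexp letter) (al : atom) (w : gtail) : Prop :=
  exists2 l, lang e l & gword l al w.

(** A test consumes nothing of the guarded string, so consecutive tests act as their conjunction,
    and Boolean axioms preserve the value at each atom. *)
Lemma glang_hyps e f al w : H (e, f) -> glang e al w -> glang f al w.
Proof.
case=> [] [] /=.
- by case=> p q pq [l ->] /= [alp ->]; exists [:: inr q] => //=;
    rewrite -(BA_axiom_beval _ pq).
- by case=> p q pq [l ->] /= [alp ->]; exists [:: inr p] => //=;
    rewrite (BA_axiom_beval _ pq).
- case=> [p q|p q||] [l ->] //= [].
  + move=> /andP[alp alq] ->; exists [:: inr p; inr q] => //.
    by exists [:: inr p] => //; exists [:: inr q].
  + move=> /orP[alp|alq] ->; first by exists [:: inr p] => //; left.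
    by exists [:: inr q] => //; right.
  + by [].
  + by move=> _ ->; exists [::].

- case=> [p q|p q||] [l].
  + move=> [u -> [v -> <-]] /= [alp [alq ->]].
    exists [:: inr (b_and p q)] => //=.
    by rewrite alp alq.
  + move=> /= [->|->] /= [alp ->]; exists [:: inr (b_or p q)] => //=;
    by rewrite alp ?orbT.
  + by [].
  + by move=> -> /= ->; exists [:: inr b_top].
Qed.

Lemma glang_hyps_closure e f al w :
  hyps_closure H (lang e) = hyps_closure H (lang f) ->
  glang e al w -> glang f al w.
Proof.
move=> ef [l le lw].
pose K : language letter :=
  [set k | forall al w, gword k al w -> glang f al w]%classic.
suff Kcl : hyps_closed H K.
  have : (hyps_closure H (lang f) `<=` K)%classic.
    apply: smallest_sub => // k kf al' w' kw; by exists k.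
  apply; last exact: lw.
  by rewrite -ef; apply: sub_gen_smallest.
(* The guarded string is cut along [u], [k], [v]. Its middle piece also belongs to some word [k'] of
   [f'], which then replaces [k] for this one guarded string. *)
move=> e' f' u v ef' fK _ [k ke <-] al' w' /gword_cat[w1 [w23 [-> uw1]]].
move=> /gword_cat[w2 [w3 [-> kw2 vw3]]].
have [k' k'f k'w2] : glang f' (gend al' w1) w2.
  by apply: glang_hyps ef' _; exists k.
apply: (fK (u ++ k' ++ v)); first by exists k'.
apply/gword_cat; exists w1, (w2 ++ w3); split=> //.
by apply/gword_cat; exists w2, w3.
Qed.

(** * Automata on guarded strings *)

Local Notation action a := (reL (inl a : letter)).

Fixpoint accepts (S : Type) (stp : S -> atom -> Sigma -> S -> bool)
    (acc : S -> atom -> bool) (s : S) (al : atom) (w : gtail) : Prop :=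
  if w is (a, ga) :: w' then
    exists2 t, stp s al a t & accepts stp acc t ga w'
  else acc s al.

(* A nondeterministic automaton reading guarded strings that accepts at least
   those of f, whose states carry expressions witnessing that it accepts
   nothing more. *)
Record recognizer (f : regexp letter) := Recognizer {
  rstate : finType;
  rini : rstate -> bool;
  rstp : rstate -> atom -> Sigma -> rstate -> bool;
  racc : rstate -> atom -> bool;
  rexp : rstate -> regexp letter;
  rini_le : forall i, rini i -> rexp i <=ka f;
  rstp_le : forall s al a t, rstp s al a t ->
    atest al * action a * rexp t <=ka rexp s;
  racc_le : forall s al, racc s al -> atest al <=ka rexp s;
  rcomplete : forall al w, glang f al w ->
    exists2 i, rini i & accepts rstp racc i al w }.

(** Covers 0, 1 and tests, whose guarded strings contain no action: one state without transitions is
    enough. *)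
Lemma recognizer_stepless f (b : atom -> bool) :
  (forall al, b al -> atest al <=ka f) ->
  (forall al w, glang f al w -> w = [::] /\ b al) -> recognizer f.
Proof.
move=> bf fb; pose stp (_ : unit) (_ : atom) (_ : Sigma) (_ : unit) := false.
apply: (@Recognizer f unit xpredT stp (fun _ => b) (fun _ => f)) => //.
by move=> al w /fb[-> bal]; exists tt.
Qed.

Lemma recognizer0 : recognizer 0.
Proof. by apply: (@recognizer_stepless 0 xpred0) => // al w [l []]. Qed.

Lemma recognizer1 : recognizer 1.
Proof.
apply: (@recognizer_stepless 1 xpredT) => [al _|al w [l -> //]].
exact: test_le1.
Qed.

Lemma recognizerL x : recognizer (reL x).
Proof.
case: x => [a|p]; last first.
  apply: (@recognizer_stepless _ (fun al => beval al p)).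
    by move=> al; apply: atest_le.
  by move=> al w [l -> /= [alp ->]].
(* State [true] still has to read [a]; state [false] has read it and accepts. *)
pose stp s (al : atom) b t := [&& s, b == a & ~~ t].
pose ex s : regexp letter := if s then action a else 1.
apply: (@Recognizer _ bool id stp (fun s _ => ~~ s) ex).
- by case.
- move=> s al b t /and3P[sT /eqP-> /negPf tF].
  by rewrite /ex sT tF /= KA_mul1r; apply: test_mull_le.
- by move=> s al /negPf sF; rewrite /ex sF; apply: test_le1.
- move=> al w [l -> /= [ga [w' [-> ->]]]]; exists true => //=.
  by exists false; rewrite /stp ?eqxx.
Qed.

Lemma recognizerD e f : recognizer e -> recognizer f -> recognizer (e + f).
Proof.
move=> [S1 ini1 stp1 acc1 ex1 ile1 sle1 ale1 cpl1].
move=> [S2 ini2 stp2 acc2 ex2 ile2 sle2 ale2 cpl2].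
pose ini s := match s with inl s => ini1 s | inr s => ini2 s end.
pose stp s al a t := match s, t with
  | inl s, inl t => stp1 s al a t | inr s, inr t => stp2 s al a t
  | _, _ => false end.
pose acc s al := match s with inl s => acc1 s al | inr s => acc2 s al end.
pose ex s := match s with inl s => ex1 s | inr s => ex2 s end.
apply: (@Recognizer _ (S1 + S2)%type ini stp acc ex).
- by case=> i /= => [/ile1|/ile2] ie; apply: KA_le_trans ie _;
    [apply: KA_leDl | apply: KA_leDr].
- by case=> [s|s] al a [t|t] //= => [/sle1|/sle2].
- by case=> [s|s] al /= => [/ale1|/ale2].
- have accl s al w : accepts stp1 acc1 s al w -> accepts stp acc (inl s) al w.
    by elim: w s al => // -[a ga] w IHw s al /= [t st /IHw tw]; exists (inl t).
  have accr s al w : accepts stp2 acc2 s al w -> accepts stp acc (inr s) al w.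
    by elim: w s al => // -[a ga] w IHw s al /= [t st /IHw tw]; exists (inr t).
  move=> al w [l [le|lf] lw].
    have [|i ii iw] := cpl1 al w; first by exists l.
    by exists (inl i) => //; apply: accl.
  have [|i ii iw] := cpl2 al w; first by exists l.
  by exists (inr i) => //; apply: accr.
Qed.

(** There are no silent transitions: a state of the first automaton accepting at [al] moves as an
    initial state of the second would at the same [al]. Idempotence of [atest al] provides one copy
    of the atom for each of the two. *)
Lemma recognizerM e f : recognizer e -> recognizer f -> recognizer (e * f).
Proof.
move=> [S1 ini1 stp1 acc1 ex1 ile1 sle1 ale1 cpl1].
move=> [S2 ini2 stp2 acc2 ex2 ile2 sle2 ale2 cpl2].
pose ini (s : S1 + S2) := if s is inl s then ini1 s else false.
pose stp s al a t := match s, t with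
  | inl s, inl t => stp1 s al a t
  | inl s, inr t => acc1 s al && [exists i, ini2 i && stp2 i al a t]
  | inr s, inr t => stp2 s al a t
  | inr _, inl _ => false end.
pose acc s al := match s with
  | inl s => acc1 s al && [exists i, ini2 i && acc2 i al]
  | inr s => acc2 s al end.
pose ex s := match s with inl s => ex1 s * f | inr s => ex2 s end.
apply: (@Recognizer _ (S1 + S2)%type ini stp acc ex).
- by case=> i //= /ile1 ie; apply: KA_le_mulr.
- case=> [s|s] al a [t|t] //=.
  + by move=> /sle1 st; rewrite KA_mulA; apply: KA_le_mulr.
  + move=> /andP[/ale1 sal /existsP[i /andP[/ile2 ie /sle2 it]]].
    rewrite -[atest al]atest_mulxx -!KA_mulA; apply: KA_le_mul2 => //.
    by rewrite KA_mulA; apply: KA_le_trans ie.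
  + exact: sle2.
- case=> [s|s] al /=; last exact: ale2.
  move=> /andP[/ale1 sal /existsP[i /andP[/ile2 ie /ale2 ial]]].
  rewrite -[atest al]atest_mulxx; apply: KA_le_mul2 => //.
  exact: KA_le_trans ie.
- have accr s al w : accepts stp2 acc2 s al w -> accepts stp acc (inr s) al w.
    by elim: w s al => // -[a ga] w IHw s al /= [t st /IHw tw]; exists (inr t).
  have accl s al w1 w2 i : accepts stp1 acc1 s al w1 -> ini2 i ->
      accepts stp2 acc2 i (gend al w1) w2 ->
      accepts stp acc (inl s) al (w1 ++ w2).
    move=> + ii; elim: w1 s al => [|[a ga] w1 IHw] s al /=.
      case: w2 => [|[a ga] w2] /=.
        by move=> -> ial; apply/existsP; exists i; rewrite ii.
      move=> sal [t it /accr tw]; exists (inr t) => //=.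
      by rewrite sal; apply/existsP; exists i; rewrite ii.
    by move=> [t st tw] iw; exists (inl t) => //; apply: IHw.
  move=> al w [_ [l1 l1e [l2 l2f <-]]] /gword_cat[w1 [w2 [-> l1w l2w]]].
  have [|i ii iw] := cpl1 al w1; first by exists l1.
  have [|j jj jw] := cpl2 (gend al w1) w2; first by exists l2.
  by exists (inl i) => //; apply: accl jw.
Qed.

(** The fresh state [None] is initial and accepts the empty iteration. Any state accepting at [al]
    may restart by a first step from an old initial state. *)
Lemma recognizerS f : recognizer f -> recognizer (f^*).
Proof.
move=> [S ini1 stp1 acc1 ex1 ile1 sle1 ale1 cpl1].
pose acc s al := if s is Some s then acc1 s al else true.
pose stp s al a t := if t is Some t then
  (if s is Some s then stp1 s al a t else false) ||
  acc s al && [exists i, ini1 i && stp1 i al a t] else false.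
pose ex s := if s is Some s then ex1 s * f^* else f^*.
have acc_le s al : acc s al -> atest al * f^* <=ka ex s.
  case: s => [s|] /=; first by move=> /ale1; apply: KA_le_mulr.
  by move=> _; apply: test_mull_le.
apply: (@Recognizer _ (option S) (fun s => s == None) stp acc ex).
- by case.
- move=> s al a [t|] //= /orP[|/andP[/acc_le sal /existsP[i /andP[ii it]]]].
    case: s => //= s /sle1 st; rewrite KA_mulA; exact: KA_le_mulr.
  apply: KA_le_trans sal; rewrite /ex -[X in X * _ * _ <=ka _]atest_mulxx.
  rewrite -!KA_mulA.
  apply: KA_le_mull; apply: KA_le_trans (KA_le_mul_star _ _).
  rewrite !KA_mulA; apply: KA_le_mulr.
  exact: KA_le_trans (sle1 _ _ _ _ it) (ile1 _ ii).
- move=> s al /acc_le; apply: KA_le_trans.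
  rewrite -[X in X <=ka _](KA_mul1r H); exact/KA_le_mull/KA_le1_star.
- have accS s al w1 w2 : accepts stp1 acc1 s al w1 ->
      accepts stp acc None (gend al w1) w2 ->
      accepts stp acc (Some s) al (w1 ++ w2).
    elim: w1 s al => [|[a ga] w1 IHw] s al /=.
      case: w2 => [|[a ga] w2] //= sal [[t|] //= it tw].
      by exists (Some t) => //=; rewrite sal it orbT.
    by move=> [t st tw] Nw; exists (Some t) => /=; [rewrite st | apply: IHw].
  move=> al w [l [n _ ln] lw]; exists None => //.
  elim: n l al w ln lw => [|n IHn] l al w /=.
    by move=> -> /= ->.
  move=> [l1 l1f [l2 l2n <-]] /gword_cat[w1 [w2 [-> l1w l2w]]].
  have [|i ii iw] := cpl1 al w1; first by exists l1.
  have {IHn}Nw := IHn _ _ _ l2n l2w.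
  (* A factor without actions leaves the guarded string unchanged and is skipped. *)
  case: w1 => [|[a ga] w1] //= in l1w l2w iw Nw *.
  have [t it tw] := iw; exists (Some t); last exact: accS.
  by apply/existsP; exists i; rewrite ii.
Qed.

Lemma recognizer_of f : recognizer f.
Proof.
elim: f => [||x|e IHe f IHf|e IHe f IHf|f IHf].
- exact: recognizer0.
- exact: recognizer1.
- exact: recognizerL.
- exact: recognizerD.
- exact: recognizerM.
- exact: recognizerS.
Qed.

(** * Classes of guarded strings *)

Section RelationComposition.
Context (S : finType).
Implicit Types x y z : {set S * S}.

Definition rid : {set S * S} := [set p | p.1 == p.2]%SET.

Definition rcomp x y : {set S * S} :=
  [set p | [exists t, ((p.1, t) \in x) && ((t, p.2) \in y)]]%SET.

Lemma rcompP x y s t :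
  reflect (exists2 u, (s, u) \in x & (u, t) \in y) ((s, t) \in rcomp x y).
Proof.
rewrite inE; apply: (iffP existsP) => [[u /andP[]]|[u su ut]]; exists u => //.
by rewrite su.
Qed.

Lemma rcomp_idl x : rcomp rid x = x.
Proof.
apply/setP => -[s t]; apply/rcompP/idP => [[u]|st].
  by rewrite inE /= => /eqP->.
by exists s; rewrite ?inE.
Qed.

Lemma rcomp_idr x : rcomp x rid = x.
Proof.
apply/setP => -[s t]; apply/rcompP/idP => [[u su]|st].
  by rewrite inE /= => /eqP<-.
by exists t; rewrite ?inE.
Qed.

Lemma rcompA x y z : rcomp x (rcomp y z) = rcomp (rcomp x y) z.
Proof.
apply/setP => -[s t]; apply/rcompP/rcompP.
  move=> [u su /rcompP[v uv vt]]; exists v => //.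
  by apply/rcompP; exists u.
move=> [v /rcompP[u su uv] vt]; exists u => //.
by apply/rcompP; exists v.
Qed.

End RelationComposition.

Section Classes.
Context (f : regexp letter) (R : recognizer f).
Local Notation S := (rstate R).
Local Notation stp := (@rstp f R).
Local Notation acc := (@racc f R).
Local Notation relS := {set S * S}.

Definition step_rel (al : atom) (a : Sigma) : relS :=
  [set p | stp p.1 al a p.2]%SET.

(** Only transitions are recorded. The last atom is left to [acc], or to the next piece of the
    string, which makes the relation multiplicative. *)
Fixpoint run_rel (al : atom) (w : gtail) : relS :=
  if w is (a, ga) :: w' then rcomp (step_rel al a) (run_rel ga w')
  else rid S.

Lemma run_rel_cat al w1 w2 :
  run_rel al (w1 ++ w2) = rcomp (run_rel al w1) (run_rel (gend al w1) w2).
Proof.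
elim: w1 al => [|[a ga] w1 IHw] al /=; first by rewrite rcomp_idl.
by rewrite IHw rcompA.
Qed.

Lemma accepts_run_rel s al w : accepts stp acc s al w ->
  exists2 t, (s, t) \in run_rel al w & acc t (gend al w).
Proof.
elim: w s al => [|[a ga] w IHw] s al /=; first by exists s; rewrite ?inE.
move=> [u su /IHw[t ut tacc]]; exists t => //.
by apply/rcompP; exists u; rewrite ?inE.
Qed.

(** A vertex pairs the current atom with the relation of the run so far. The atom of [r] is guessed
    freely: the next edge tests it, or the closing [atest be] of [class_exp] does. *)
Definition cayley (q r : atom * relS) : regexp letter :=
  \re_sum_(a | r.2 == rcomp q.2 (step_rel q.1 a)) (atest q.1 * action a).

(* Denotes the guarded strings from al to be whose run relation is m. *)
Definition class_exp (al : atom) (m : relS) (be : atom) : regexp letter :=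
  atest al * mat_star cayley (al, rid S) (be, m) * atest be.

Lemma cayley_translate k al x be y :
  cayley (al, x) (be, y) <=ka cayley (al, rcomp k x) (be, rcomp k y).
Proof.
apply: KA_sum_le => a /= /eqP->; apply: KA_le_sum => /=.
by rewrite rcompA.
Qed.

(** Edges compose on the right, so composing with [k] on the left maps paths to paths. *)
Lemma cayley_star_translate k al x be y :
  mat_star cayley (al, x) (be, y) <=ka
  mat_star cayley (al, rcomp k x) (be, rcomp k y).
Proof.
(* The column of translated entries towards the fixed target absorbs [cayley], and its entry at the
   target is above 1. *)
pose z (q : atom * relS) := mat_star cayley (q.1, rcomp k q.2) (be, rcomp k y).
have zle : forall q r, cayley q r * z r <=ka z q.
  move=> [ga u] [de v].
  apply: KA_le_trans (mat_star_trans _ _ (de, rcomp k v) _ _).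
  apply: KA_le_mulr; apply: KA_le_trans (cayley_translate k _ _ _ _) _.
  exact: le_mat_star.
apply: KA_le_trans (mat_star_least zle (al, x) (be, y)).
rewrite -[X in X <=ka _](KA_mul1r H); apply: KA_le_mull; exact: mat_star1.
Qed.

(** The second path is translated by [m], so that it starts at [(be, m)] where the first one
    ends. *)
Lemma class_expM al m be n ga :
  class_exp al m be * class_exp be n ga <=ka class_exp al (rcomp m n) ga.
Proof.
rewrite /class_exp !KA_mulA; apply: KA_le_mulr.
rewrite -!KA_mulA; apply: KA_le_mull.
apply: KA_le_trans (mat_star_trans _ _ (be, m) _ _); apply: KA_le_mull.
do 2!apply: KA_le_trans (test_mull_le _ _) _.
by have := cayley_star_translate m be (rid S) ga n; rewrite rcomp_idr.
Qed.

Lemma class_expM_neq al m be be' n ga :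
  be != be' -> class_exp al m be * class_exp be' n ga <=ka 0.
Proof.
move=> /atest_mul_neq bebe'; rewrite /class_exp -!KA_mulA.
rewrite (KA_mulA H (atest be)).
apply: KA_le_trans (KA_le_mull _ (KA_le_mull _ (KA_le_mulr _ bebe'))) _.
by rewrite KA_mul0l !KA_mul0r.
Qed.

Definition meets_class (e : regexp letter) (t : atom * relS * atom) : bool :=
  `[< exists w, [/\ glang e t.1.1 w, run_rel t.1.1 w = t.1.2
                  & gend t.1.1 w = t.2] >].

Definition class_sum (e : regexp letter) : regexp letter :=
  \re_sum_(t | meets_class e t) class_exp t.1.1 t.1.2 t.2.

Lemma class_exp_le_sum e al w : glang e al w ->
  class_exp al (run_rel al w) (gend al w) <=ka class_sum e.
Proof.
move=> ew; apply: (KA_le_sum _ _ (j := (al, run_rel al w, gend al w))).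
by apply/asboolP; exists w.
Qed.

Lemma class_sumS e e' : (forall al w, glang e al w -> glang e' al w) ->
  class_sum e <=ka class_sum e'.
Proof.
move=> ee'; apply: KA_sum_le => -[[al m] be] /asboolP[w /= [/ee' e'w <- <-]].
exact: class_exp_le_sum.
Qed.

(** If the atoms match, the concatenated representatives witness that [e] meets the product class;
    otherwise the product of the two class expressions is 0. *)
Lemma class_sumM e1 e2 e :
  (forall al w1 w2, glang e1 al w1 -> glang e2 (gend al w1) w2 ->
     glang e al (w1 ++ w2)) ->
  class_sum e1 * class_sum e2 <=ka class_sum e.
Proof.
move=> eM; apply: KA_sum_mulr_le => -[[al m] be] /asboolP[w1 /= [e1w <- <-]].
apply: KA_sum_mull_le => -[[be' n] ga] /asboolP[w2 /= [e2w <- <-]].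
have [be'E|/class_expM_neq neq0] := eqVneq (gend al w1) be'.
  rewrite -be'E in e2w *; apply: KA_le_trans (class_expM _ _ _ _ _) _.
  rewrite -run_rel_cat -gend_cat; exact/class_exp_le_sum/eM.
exact: KA_le_trans (neq0 _ _ _ _) (KA_le0x _ _).
Qed.

Lemma atest_le_class_sum e al : glang e al [::] -> atest al <=ka class_sum e.
Proof.
move=> /class_exp_le_sum; apply: KA_le_trans.
rewrite -[atest al]atest_mulxx; apply: KA_le_mulr.
rewrite -[X in X <=ka _](KA_mul1r H); apply: KA_le_mull; exact: mat_star1.
Qed.

(** Split 1 into atoms: those satisfying [p] lie below classes of action-free strings, and the
    others annihilate [p]. *)
Lemma test_le_class_sum e p :
  (forall al, beval al p -> glang e al [::]) -> test p <=ka class_sum e.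
Proof.
move=> pe; rewrite -[X in X <=ka _](KA_mul1l H).
apply: KA_le_trans (KA_le_mulr _ sum_atest) _.
apply: KA_sum_mulr_le => al _; have [/pe|/atest_mul_le0] := boolP (beval al p).
  by move=> /atest_le_class_sum; apply: KA_le_trans; apply: test_mulr_le.
by move=> alp0; apply: KA_le_trans alp0 (KA_le0x _ _).
Qed.

Lemma one_le_class_sum e :
  (forall al, glang e al [::]) -> 1 <=ka class_sum e.
Proof. by move=> e1; rewrite -test_top; apply: test_le_class_sum. Qed.

Lemma action_le_class_sum a : action a <=ka class_sum (action a).
Proof.
rewrite -[X in X <=ka _](KA_mul1l H).
apply: KA_le_trans (KA_le_mulr _ sum_atest) _.
apply: KA_sum_mulr_le => al _; rewrite -[X in X <=ka _](KA_mul1r H).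
apply: KA_le_trans (KA_le_mull _ sum_atest) _.
apply: KA_sum_mull_le => be _.
have lw : glang (action a) al [:: (a, be)].
  by exists [:: inl a] => //; exists be, [::].
apply: KA_le_trans (class_exp_le_sum lw).
rewrite /class_exp /= rcomp_idr; apply: KA_le_mulr.
rewrite -[X in X * _ <=ka _]atest_mulxx -KA_mulA; apply: KA_le_mull.
apply: KA_le_trans (le_mat_star _ _ _ _); apply: (KA_le_sum _ _ (j := a)) => /=.
by rewrite rcomp_idl.
Qed.

Lemma le_class_sum e : e <=ka class_sum e.
Proof.
elim: e => [||[a|p]|e1 IH1 e2 IH2|e1 IH1 e2 IH2|e IHe].
- exact: KA_le0x.
- by apply: one_le_class_sum => al; exists [::].
- exact: action_le_class_sum.
- by apply: test_le_class_sum => al alp; exists [:: inr p].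
- apply: KA_leUD; [apply: KA_le_trans IH1 _ | apply: KA_le_trans IH2 _];
    apply: class_sumS => al w [l le lw]; exists l => //; by [left | right].
- apply: KA_le_trans (KA_le_mul2 IH1 IH2) _.
  apply: class_sumM => al w1 w2 [l1 le1 lw1] [l2 le2 lw2]; exists (l1 ++ l2).
    by exists l1 => //; exists l2.
  by apply/gword_cat; exists w1, w2.
(* Star induction: the class sum of the star is above 1 and absorbs that of [e] on the left. *)
- apply: KA_star_le.
    by apply: one_le_class_sum => al; exists [::] => //; exists 0%N.
  apply: KA_le_trans (KA_le_mulr _ IHe) _.
  apply: class_sumM => al w1 w2 [l1 le1 lw1] [l2 [n _ le2] lw2].
  exists (l1 ++ l2); last by apply/gword_cat; exists w1, w2.
  by exists n.+1 => //; exists l1 => //; exists l2.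
Qed.

(** One string of [f] decides for its whole class, because acceptance depends only on the relation
    and the last atom. *)
Lemma class_exp_le al w :
  glang f al w -> class_exp al (run_rel al w) (gend al w) <=ka f.
Proof.
move=> /(rcomplete R)[i ii /accepts_run_rel[s ims sacc]].
pose reached (m : relS) t := [exists i, rini i && ((i, t) \in m)].
(* At the identity relation only initial states are reached, so [z] is below [f] there. At the end
   of [w] an accepting state is reached, so [z] is above the last atom. *)
pose z (q : atom * relS) := \re_sum_(t | reached q.2 t) rexp t.
have zle : forall q r, cayley q r * z r <=ka z q.
  move=> [be m] [ga n]; apply: KA_sum_mulr_le => a /= /eqP->.
  apply: KA_sum_mull_le => t /= /existsP[j /andP[jj /rcompP[u ju]]].
  rewrite inE /= => /rstp_le ut; apply: KA_le_trans ut _.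
  by apply: KA_le_sum; apply/existsP; exists j; rewrite jj.
rewrite /class_exp -KA_mulA; apply: KA_le_trans (test_mull_le _ _) _.
apply: (KA_le_trans (y := z (al, rid S))); last first.
  apply: KA_sum_le => t /existsP[j /andP[jj]]; rewrite inE /= => /eqP <-.
  exact: rini_le.
apply: KA_le_trans (mat_star_least zle _ (gend al w, run_rel al w)).
apply: KA_le_mull; apply: KA_le_trans (racc_le sacc) _.
by apply: KA_le_sum; apply/existsP; exists i; rewrite ii.
Qed.

End Classes.

(** * Completeness for inclusion of guarded-string languages *)

Lemma glang_sub_KA_le e f :
  (forall al w, glang e al w -> glang f al w) -> e <=ka f.
Proof.
move=> ef; apply: KA_le_trans (le_class_sum (recognizer_of f) e) _.
apply: KA_sum_le => -[[al m] be] /asboolP[w /= [/ef fw <- <-]].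
exact: class_exp_le.
Qed.

End KAT.

Theorem theorem4p10 (Sigma Omega : finType)
    (e f : regexp (kat_letter Sigma Omega)) :
  hyps_closure (hyps_kat Sigma Omega) (lang e) =
    hyps_closure (hyps_kat Sigma Omega) (lang f) ->
  KA_eq (hyps_kat Sigma Omega) e f.
Proof.
move=> ef; apply: KA_le_anti; apply: glang_sub_KA_le => al w.
  exact: glang_hyps_closure.
exact/glang_hyps_closure/esym.
Qed.
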